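(* Let $k=2\log n$ and let $t(k,1)<k/2$ be a threshold such that $I[\tau^{t(k,1)}_k]=1-o(1)$ (with $o(1)$ with respect to $k$). For every $I^*$ with $2\le I^*\le \sqrt n/\log n$, there exists a family $F_{I^*}$ of monotone functions $\{0,1\}^n\to\{0,1\}$ such that $I[f]\ge I^*$ for every $f\in F_{I^*}$, but any algorithm (with query access to the function) that distinguishes with probability at least $2/3$ between a uniformly selected function in $F_{I^*}$ and $\tau^{t(k,1)}_k$ must perform $\Omega\!\left(\frac{\sqrt n}{I^*\cdot\log n}\right)$ queries.
   Context: For $x\in\{0,1\}^n$, $x^{(\oplus i)}$ denotes $x$ with its $i$-th bit flipped; the influence of $f:\{0,1\}^n\to\{0,1\}$ is $I[f]=\sum_{i=1}^n\Pr_x[f(x)\ne f(x^{(\oplus i)})]$ with $x$ uniform in $\{0,1\}^n$. A function is monotone if $f(x)\le f(y)$ whenever $x_i\le y_i$ for all $i$. For integers $1\le k\le n$ and $0\le t\le k$, $\tau^t_k:\{0,1\}^n\to\{0,1\}$ is the $t$-threshold function on $x_1,\dots,x_k$: $\tau^t_k(x)=1$ iff $\sum_{i=1}^k x_i\ge t$; one has $I[\tau^t_k]=k\cdot 2^{-(k-1)}\binom{k-1}{t-1}$, and for $k$ sufficiently large (e.g. $k\ge 2\log n$) a threshold $t(k,1)<k/2$ with $I[\tau^{t(k,1)}_k]=1-o(1)$ exists. *)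

(* Defs.v *)
From HB Require Import structures.
From mathcomp Require Import all_boot all_order all_algebra.
From mathcomp Require Import all_classical all_reals all_analysis.

Set Implicit Arguments.
Unset Strict Implicit.
Unset Printing Implicit Defensive.

Import Order.TTheory GRing.Theory Num.Theory.
Import numFieldNormedType.Exports.

Local Open Scope ring_scope.

Notation cube n := {ffun 'I_n -> bool}.
Notation boolfun n := {ffun cube n -> bool}.

Definition flip (n : nat) (x : cube n) (i : 'I_n) : cube n :=
  [ffun j => if j == i then ~~ x j else x j].

Definition unif_pr (R : realType) (T : finType) (E : pred T) : R :=
  #|E|%:R / #|T|%:R.

Definition influence (R : realType) (n : nat) (f : boolfun n) : R :=
  \sum_(i < n) unif_pr R (fun x : cube n => f x != f (flip x i)).

Definition monotone_boolfun (n : nat) (f : boolfun n) : Prop :=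
  forall x y : cube n, (forall i : 'I_n, (x i <= y i)%N) -> (f x <= f y)%N.

(* Coordinates are numbered from 0, so x_1, ..., x_k are the i with i < k. *)
Definition threshold (n k t : nat) : boolfun n :=
  [ffun x : cube n => (t <= \sum_(i < n | (i < k)%N) x i)%N].

(* For n = 0 the library's convention ln 0 = 0 gives log2 0 = 0. *)
Definition log2 (R : realType) (x : R) : R := ln x / ln 2.

(* The parameter k = 2 log n, rounded up to an integer. *)
Definition klog (R : realType) (n : nat) : nat :=
  `|Num.ceil (2 * log2 (n%:R : R))|%N.

(* A deterministic adaptive query algorithm: [Query x t0 t1] asks for the value
   of the function at x and continues with t0 on answer 0, with t1 on answer 1. *)
Inductive dtree (n : nat) : Type :=
  | Output (b : bool)
  | Query (x : cube n) (t0 t1 : dtree n).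

Fixpoint run (n : nat) (T : dtree n) (f : boolfun n) : bool :=
  match T with
  | Output b => b
  | Query x t0 t1 => if f x then run t1 f else run t0 f
  end.

Fixpoint nqueries (n : nat) (T : dtree n) (f : boolfun n) : nat :=
  match T with
  | Output _ => 0%N
  | Query x t0 t1 => (if f x then nqueries t1 f else nqueries t0 f).+1
  end.

(* A randomized algorithm is a distribution over deterministic ones. A finite
   seed type with arbitrary real weights loses no generality: algorithms with
   a bounded number of queries have only finitely many distinct behaviours. *)
Record ralg (R : realType) (n : nat) : Type := RAlg {
  seed : finType;
  weight : seed -> R;
  tree : seed -> dtree n;
  weight_ge0 : forall s : seed, 0 <= weight s;
  weight_sum1 : \sum_(s : seed) weight s = 1 }.

Definition pr_output (R : realType) (n : nat) (A : ralg R n) (b : bool)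
    (f : boolfun n) : R :=
  \sum_(s : seed A | run (tree s) f == b) weight s.

(* The number of queries A makes on f, in the worst case over its coins. *)
Definition query_count (R : realType) (n : nat) (A : ralg R n)
    (f : boolfun n) : nat :=
  \max_(s : seed A) nqueries (tree s) f.

(* A is correct with probability at least 2/3 in each of the two cases: output
   true stands for "a random member of F", output false for "g". In the first
   case the probability is over both the choice of f in F and the coins of A. *)
Definition distinguishes (R : realType) (n : nat) (A : ralg R n)
    (F : {set boolfun n}) (g : boolfun n) : Prop :=
  2 / 3 <= (\sum_(f in F) pr_output A true f) / #|F|%:R /\
  2 / 3 <= pr_output A false g.

(* Main.v *)
Require Import Defs.
From HB Require Import structures.
From mathcomp Require Import all_boot all_order all_algebra.
From mathcomp Require Import all_classical all_reals all_analysis.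
From mathcomp Require Import zify ring lra.

Set Implicit Arguments.
Unset Strict Implicit.
Unset Printing Implicit Defensive.

Import Order.TTheory GRing.Theory Num.Theory.
Import numFieldNormedType.Exports.
Local Open Scope classical_set_scope.
Local Open Scope ring_scope.

(* Let k = klog n, and let L be the layer of prefixes y in {0,1}^k of weight t.
   Since I[tau] is close to 1 and t < k/2, the layer L has at least 2^k / (2k)
   elements. Replacing tau by a majority of the last n - k coordinates over a set
   S of prefixes in L keeps it monotone and creates influence of order
   (|S| / 2^k) sqrt n, so |S| of order I* 2^k / sqrt n suffices. L contains
   B = Omega(sqrt n / (I* log n)) disjoint sets S of this size; the family consists
   of the B resulting functions. A query separates at most one of them from tau, so
   a distinguisher needs at least B / 3 queries. When sqrt n / (I* log n) is bounded,
   a single majority function does instead, because a distinguisher always makes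
   at least one query. *)

(** * Hamming weight and the layers of the cube *)

Definition hweight (n : nat) (x : cube n) : nat := (\sum_(i < n) x i)%N.

Lemma flipK (n : nat) (i : 'I_n) : involutive (fun x : cube n => flip x i).
Proof.
move=> x; apply/ffunP => j; rewrite !ffunE.
by case: eqP => // ->; rewrite negbK.
Qed.

Lemma hweight_flip (n : nat) (x : cube n) (i : 'I_n) :
  x i -> hweight x = (hweight (flip x i)).+1.
Proof.
move=> xi; rewrite /hweight (bigD1 i) //= [in RHS](bigD1 i) //= ffunE eqxx xi.
rewrite add1n add0n; congr _.+1; apply: eq_bigr => j ji.
by rewrite ffunE (negbTE ji).
Qed.

Lemma leq_hweight (n : nat) (x y : cube n) :
  (forall i, (x i <= y i)%N) -> (hweight x <= hweight y)%N.
Proof. by move=> xy; apply: leq_sum. Qed.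

Lemma hweight_inj (n : nat) (x y : cube n) :
  (forall i, (x i <= y i)%N) -> hweight x = hweight y -> x = y.
Proof.
move=> xy /eqP; rewrite /hweight => e.
have := leqif_sum (fun (i : 'I_n) (_ : true) => leqif_eq (xy i)).
case=> _; rewrite e => /esym/forallP h.
by apply/ffunP => i; move/eqP: (h i); case: (x i); case: (y i).
Qed.

Lemma card_cube (n : nat) : #|{: cube n}| = (2 ^ n)%N.
Proof. by rewrite card_ffun card_bool card_ord. Qed.

Lemma card_hweight (n s : nat) :
  #|[set x : cube n | hweight x == s]%SET| = 'C(n, s).
Proof.
rewrite -[n in RHS]card_ord -card_draws.
pose h (x : cube n) : {set 'I_n} := [set i | x i]%SET.
have hinj : injective h.
  by move=> x y /setP e; apply/ffunP => i; move: (e i); rewrite !inE.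
rewrite -(card_imset _ hinj); apply: eq_card => A; rewrite inE.
apply/imsetP/idP => [[x]|].
  rewrite inE => /eqP <- ->; apply/eqP.
  by rewrite -sum1_card big_mkcond /=; apply: eq_bigr => i _; rewrite inE; case: (x i).
move=> /eqP <-; exists [ffun i => i \in A].
  rewrite inE; apply/eqP; rewrite -sum1_card [RHS]big_mkcond /=.
  by apply: eq_bigr => i _; rewrite ffunE; case: (i \in A).
by apply/setP => i; rewrite inE ffunE.
Qed.

(** Double counting of the pairs (x, i) with x_i = 1: each x in the layer has exactly s such i. *)
Lemma sum_card_hweight (n s : nat) :
  (\sum_(i < n) #|[set x : cube n | (hweight x == s) && x i]%SET| = s * 'C(n, s))%N.
Proof.
transitivity (\sum_(i < n) \sum_(x : cube n | hweight x == s) (x i : nat))%N.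
  apply: eq_bigr => i _; rewrite -sum1_card big_mkcond [RHS]big_mkcond /=.
  by apply: eq_bigr => x _; rewrite inE; case: (hweight x == s); case: (x i).
rewrite exchange_big /= -card_hweight mulnC -sum_nat_const.
rewrite [RHS](eq_bigl (fun x => hweight x == s)); last by move=> x; rewrite inE.
by apply: eq_bigr => x /eqP.
Qed.

(** * Influence as a count of boundary points *)

Lemma influenceE (R : realType) (n : nat) (f : boolfun n) :
  influence R f =
  (\sum_(i < n) #|[set x | f x != f (flip x i)]%SET|)%:R / (2 ^ n)%:R.
Proof.
rewrite /influence /unif_pr natr_sum mulr_suml; apply: eq_bigr => i _.
by rewrite card_cube cardsE.
Qed.

Lemma thresholdE (k m t : nat) (x : cube (k + m)) :
  threshold (k + m) k t x = (t <= hweight [ffun i => x (lshift m i)])%N.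
Proof.
rewrite ffunE big_mkcond big_split_ord /= [X in (_ + X)%N]big1 ?addn0; last first.
  by move=> i _; rewrite ltnNge leq_addr.
by congr (_ <= _)%N; apply: eq_bigr => i _; rewrite ltn_ord ffunE.
Qed.

(** Every boundary edge in direction i has its upper end in the layer of weight t with i-th bit 1;
    the factor 2 counts both ends. Read backwards, large influence forces a large layer. *)
Lemma influence_threshold (R : realType) (k t : nat) :
  influence R (threshold k k t) <= (2 * (t * 'C(k, t)))%:R / (2 ^ k)%:R.
Proof.
rewrite influenceE ler_pM2r ?invr_gt0 ?ltr0n ?expn_gt0// ler_nat.
rewrite -sum_card_hweight big_distrr /=; apply: leq_sum => i _.
have tE (x : cube k) : threshold k k t x = (t <= hweight x)%N.
  by rewrite ffunE; congr (_ <= _)%N; apply: eq_bigl => j; rewrite ltn_ord.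
pose S := [set x : cube k | (hweight x == t) && x i]%SET.
apply: (@leq_trans #|S :|: [set flip x i | x in S]%SET|%SET).
  apply/subset_leq_card/fintype.subsetP => x; rewrite !inE !tE => sx.
  case xi: (x i).
    apply/orP; left; rewrite andbT; move: sx; rewrite (hweight_flip xi); lia.
  apply/orP; right; apply/imsetP; exists (flip x i); last by rewrite flipK.
  have fi : flip x i i by rewrite ffunE eqxx xi.
  rewrite inE fi andbT; move: sx (hweight_flip fi); rewrite flipK; lia.
rewrite mul2n -addnn (leq_trans (leq_card_setU _ _))//.
by rewrite leq_add2l leq_imset_card.
Qed.

(** * Lower bounds on central binomial coefficients, squared to stay within the natural numbers *)

Lemma central_bin_lower (j : nat) : (0 < j)%N ->
  (16 ^ j <= 4 * j * 'C(j.*2, j) ^ 2)%N.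
Proof.
elim: j => // -[_ _|j IH _]; first by [].
have {}IH := IH isT; set i := j.+1 in IH *.
(* Ratio of consecutive central coefficients: 2(2i+1)/(i+1). *)
have e : (i.+1 * 'C(i.+1.*2, i.+1) = 2 * (i.*2.+1) * 'C(i.*2, i))%N.
  rewrite doubleS -mul_bin_diag /= -doubleS -mul2n -mulnA mulnA -!mulnA; congr muln.
  rewrite (mul_bin_down i.*2.+1 i); congr muln; lia.
set C := 'C(_, _) in IH e; set D := 'C(_, _) in e *.
rewrite expnS -(leq_pmul2r (m := (i * i.+1)%N))//.
have -> : (4 * i.+1 * D ^ 2 * (i * i.+1) = 4 * i * (i.+1 * D) ^ 2)%N by ring.
rewrite e.
apply: (@leq_trans (16 * (4 * i * C ^ 2) * (i * i.+1))%N).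
  by rewrite leq_mul2r leq_mul2l IH !orbT.
have -> : (4 * i * (2 * i.*2.+1 * C) ^ 2 = 16 * (4 * i * C ^ 2) * (i * i.+1) + 16 * i * C ^2)%N.
  rewrite -muln2; ring.
by rewrite leq_addr.
Qed.

(** The even case is the central bound itself; the odd case m = 2j+1 reduces to it by (j+1) C(2j+1,
    j+1) = (2j+1) C(2j, j). *)
Lemma uphalf_bin_lower (m : nat) :
  (m * 4 ^ m <= 8 * (uphalf m * 'C(m, uphalf m)) ^ 2)%N.
Proof.
rewrite -[m]odd_double_half; set j := m./2.
case: (posnP j) => [->|j0]; first by case: (odd m).
have := central_bin_lower j0; set C := 'C(_, _) => h.
have e4 : (4 ^ j.*2 = 16 ^ j)%N by rewrite -mul2n expnM.
case: (odd m); last first.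
  rewrite (_ : (false + j.*2)%N = j.*2)// uphalf_double -/C e4.
  apply: (@leq_trans (j.*2 * (4 * j * C ^ 2))%N); first by rewrite leq_mul2l h orbT.
  by rewrite -mul2n leq_eqVlt; apply/orP; left; apply/eqP; ring.
rewrite (_ : (true + j.*2)%N = j.*2.+1)// (_ : uphalf j.*2.+1 = j.+1); last by rewrite uphalfE -doubleS doubleK.
rewrite -mul_bin_diag /= -/C expnS e4.
apply: (@leq_trans (j.*2.+1 * (4 * (4 * j * C ^ 2)))%N).
  by rewrite !leq_mul2l h !orbT.
have -> : (8 * (j.*2.+1 * C) ^ 2 =
   j.*2.+1 * (4 * (4 * j * C ^ 2)) + 8 * j.*2.+1 * C ^ 2)%N by rewrite -mul2n; ring.
by rewrite leq_addr.
Qed.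

(** * Planting a threshold of the suffix on selected prefixes *)

Definition prefix_of (k m : nat) (x : cube (k + m)) : cube k :=
  [ffun i => x (lshift m i)].

Definition suffix_of (k m : nat) (x : cube (k + m)) : cube m :=
  [ffun i => x (rshift k i)].

Definition glue (k m : nat) (y : cube k) (z : cube m) : cube (k + m) :=
  [ffun i => match fintype.split i with inl a => y a | inr b => z b end].

Lemma glue_lshift (k m : nat) (y : cube k) (z : cube m) (i : 'I_k) :
  glue y z (lshift m i) = y i.
Proof. by rewrite ffunE -[lshift _ _]/(unsplit (inl i)) unsplitK. Qed.

Lemma glue_rshift (k m : nat) (y : cube k) (z : cube m) (i : 'I_m) :
  glue y z (rshift k i) = z i.
Proof. by rewrite ffunE -[rshift _ _]/(unsplit (inr i)) unsplitK. Qed.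

Lemma prefix_of_glue (k m : nat) (y : cube k) (z : cube m) :
  prefix_of (glue y z) = y.
Proof. by apply/ffunP => i; rewrite ffunE glue_lshift. Qed.

Lemma suffix_of_glue (k m : nat) (y : cube k) (z : cube m) :
  suffix_of (glue y z) = z.
Proof. by apply/ffunP => i; rewrite ffunE glue_rshift. Qed.

(* Intended for [S] inside the layer of weight [t], where [threshold] is minimally 1. *)
Definition planted (k m t s : nat) (S : {set cube k}) : boolfun (k + m) :=
  [ffun x => if prefix_of x \in S then (s <= hweight (suffix_of x))%N
             else (t <= hweight (prefix_of x))%N].

Lemma monotone_planted (k m t s : nat) (S : {set cube k}) :
  S \subset [set y | hweight y == t]%SET -> monotone_boolfun (planted m t s S).
Proof.
move=> /fintype.subsetP SL x x' xx'; rewrite !ffunE.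
have SLt y : y \in S -> hweight y = t by move/SL; rewrite inE => /eqP.
have pp i : (prefix_of x i <= prefix_of x' i)%N by rewrite !ffunE.
have pw := leq_hweight pp.
have sw : (hweight (suffix_of x) <= hweight (suffix_of x'))%N.
  by apply: leq_hweight => i; rewrite !ffunE.
have imp (a b : bool) : (a -> b) -> (a <= b)%N.
  by case: a b => [] [] // /(_ isT).
have [xS|xS] := boolP (prefix_of x \in S); have [x'S|x'S] := boolP (prefix_of x' \in S).
- by apply: imp => h; apply: leq_trans h sw.
- by apply: imp => _; rewrite -(SLt _ xS).
(* A layer is an antichain: a prefix outside [S] lying below one in [S] has weight less than t, so
   the function is 0 there. *)
- apply: imp => h; have e := SLt _ x'S.
  have /(hweight_inj pp) pe : hweight (prefix_of x) = hweight (prefix_of x').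
    by apply/eqP; rewrite eqn_leq pw e h.
  by rewrite pe x'S in xS.
- by apply: imp => h; apply: leq_trans h pw.
Qed.

(** Only suffix directions are counted, and in them only the upper ends: prefix in [S], suffix of
    weight s with the flipped bit equal to 1. *)
Lemma influence_planted (R : realType) (k m t s : nat) (S : {set cube k}) :
  (#|S| * (s * 'C(m, s)))%:R / (2 ^ (k + m))%:R <= influence R (planted m t s S).
Proof.
rewrite influenceE ler_pM2r ?invr_gt0 ?ltr0n ?expn_gt0// ler_nat.
rewrite -sum_card_hweight big_distrr /= big_split_ord /=.
rewrite (leq_trans _ (leq_addl _ _))//; apply: leq_sum => i _.
rewrite -cardsX.
set Z := [set z | _]%SET.
rewrite -(card_imset (f := fun p => glue p.1 p.2) (finset.setX S Z)); last first.
  move=> [y z] [y' z'] /= e.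
  have -> : y = y' by rewrite -(prefix_of_glue y z) e prefix_of_glue.
  by have -> : z = z' by rewrite -(suffix_of_glue y z) e suffix_of_glue.
apply/subset_leq_card/fintype.subsetP => x /imsetP[[y z]].
rewrite !inE /= => /and3P[yS /eqP zs zi] ->.
have fp : prefix_of (flip (glue y z) (rshift k i)) = y.
  by apply/ffunP => j; rewrite ffunE [LHS]ffunE eq_lrshift glue_lshift.
have fs : suffix_of (flip (glue y z) (rshift k i)) = flip z i.
  by apply/ffunP => j; rewrite ffunE [LHS]ffunE [RHS]ffunE eq_rshift glue_rshift.
rewrite !ffunE fp fs prefix_of_glue suffix_of_glue yS zs leqnn.
by have := hweight_flip zi; rewrite zs => ->; rewrite ltnn.
Qed.

Lemma planted_neq (k m t s : nat) (S : {set cube k}) (x : cube (k + m)) :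
  planted m t s S x != threshold (k + m) k t x -> prefix_of x \in S.
Proof.
by rewrite thresholdE ffunE; case: (prefix_of x \in S) => //; rewrite eqxx.
Qed.

Lemma planted_inj (k m t s : nat) (J : Type) (S : J -> {set cube k}) :
  (0 < s)%N -> (forall j, S j \subset [set y | hweight y == t]%SET) ->
  (forall j, S j != finset.set0) ->
  (forall y j j', y \in S j -> y \in S j' -> j = j') ->
  injective (fun j => planted m t s (S j)).
Proof.
move=> s0 SL S0 Sd j j' /ffunP e.
have [y yS] := set0Pn _ (S0 j); apply: (Sd y) => //.
(* At the zero suffix the function planted on [S j] is 0 because s > 0, whereas a function whose set
   misses y is 1 because y has weight t. *)
have := e (glue y [ffun=> false]); rewrite !ffunE prefix_of_glue suffix_of_glue yS.
have -> : hweight ([ffun=> false] : cube m) = 0%N.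
  by apply: big1 => i _; rewrite ffunE.
have /fintype.subsetP/(_ _ yS) := SL j; rewrite inE => /eqP ->.
by case: (y \in S j'); rewrite ?leqnn // leqNgt s0.
Qed.

(** * Query lower bound for pairwise separated perturbations *)

Lemma run_neq_le (n : nat) (F : {set boolfun n}) (g : boolfun n) (T : dtree n) :
  (forall x, #|[set f in F | f x != g x]%SET| <= 1)%N ->
  (#|[set f in F | run T f != run T g]%SET| <= nqueries T g)%N.
Proof.
move=> Fg; elim: T => [b|x T0 IH0 T1 IH1] /=.
  rewrite leqn0 cards_eq0; apply/eqP/setP => f.
  by rewrite !inE eqxx andbF.
pose T := if g x then T1 else T0.
have IH : (#|[set f in F | run T f != run T g]%SET| <= nqueries T g)%N.
  by rewrite /T; case: (g x).
(* Either f already differs from g at the queried point, which at most one f does, or both descend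
   into the same subtree. *)
apply: (@leq_trans #|[set f in F | f x != g x] :|: [set f in F | run T f != run T g]|%SET).
  apply/subset_leq_card/fintype.subsetP => f; rewrite !inE.
  move=> /andP[-> /=]; rewrite /T.
  by case: (f x) (g x) => [] [].
rewrite (leq_trans (leq_card_setU _ _))// -add1n.
have -> : (if g x then nqueries T1 g else nqueries T0 g) = nqueries T g.
  by rewrite /T; case: (g x).
by rewrite leq_add.
Qed.

Lemma pr_output_sum (R : realType) (n : nat) (A : ralg R n) (f : boolfun n) :
  pr_output A true f + pr_output A false f = 1.
Proof.
rewrite /pr_output -(weight_sum1 A) [RHS](bigID (fun s => run (tree s) f == true)).
by congr (_ + _); apply: eq_bigl => s; case: run.
Qed.

(* A seed on which [g] is rejected accepts only members of [F] separated from [g]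
   by one of its queries, so [F] is accepted with probability at most
   [Pr[g accepted] + q / #|F|]. *)
Lemma distinguishes_card (R : realType) (n : nat) (A : ralg R n) (q : nat)
    (F : {set boolfun n}) (g : boolfun n) :
  F != finset.set0 ->
  (forall x, #|[set f in F | f x != g x]%SET| <= 1)%N ->
  distinguishes A F g -> (query_count A g <= q)%N ->
  #|F|%:R <= 3 * q%:R :> R.
Proof.
move=> F0 Fg [hF hg] hq.
have F_gt0 : 0 < #|F|%:R :> R by rewrite ltr0n card_gt0.
move: hF; rewrite ler_pdivlMr// => hF.
have le : \sum_(f in F) pr_output A true f <=
    #|F|%:R * pr_output A true g + q%:R.
  rewrite /pr_output.
  under eq_bigr do rewrite big_mkcond /=.
  have -> : q%:R = \sum_(s : seed A) q%:R * weight s :> R.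
    by rewrite -mulr_sumr weight_sum1 mulr1.
  rewrite exchange_big /= [X in _ * X]big_mkcond mulr_sumr -big_split /=; apply: ler_sum => s _.
  have qs : (#|[set f in F | run (tree s) f != run (tree s) g]%SET| <= q)%N.
    rewrite (leq_trans (run_neq_le _ Fg))// (leq_trans _ hq)//.
    exact: (leq_bigmax s).
  rewrite -big_mkcondr sumr_const /=.
  case: eqP => [_|/eqP/negbTE gs].
    rewrite -[_ *+ _]mulr_natl -mulrDl ler_wpM2r ?weight_ge0//.
    apply: (@le_trans _ _ #|F|%:R); last by rewrite lerDl.
    rewrite ler_nat.
    by apply/subset_leq_card/fintype.subsetP => f; rewrite unfold_in => /andP[].
  rewrite mulr0 add0r -[weight s *+ _]mulr_natl ler_wpM2r ?weight_ge0// ler_nat.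
  apply: leq_trans qs; apply/subset_leq_card/fintype.subsetP => f /andP[fF /eqP ft].
  rewrite inE fF ft /=.
  by move: gs; case: run.
(* Since g is accepted with probability at most 1/3, 2/3 |F| <= |F|/3 + q. *)
have := pr_output_sum A g; nra.
Qed.

(** * Construction of the families *)

Lemma disjoint_blocks (T : finType) (L : {set T}) (B m : nat) :
  (B * m <= #|L|)%N ->
  exists S : 'I_B -> {set T},
    [/\ forall j, S j \subset L, forall j, #|S j| = m &
        forall x j j', x \in S j -> x \in S j' -> j = j'].
Proof.
move=> BmL; have le : (#|{: 'I_B * 'I_m}| <= #|L|)%N by rewrite card_prod !card_ord.
pose h p : T := enum_val (widen_ord le (enum_rank p)).
have hinj : injective h.
  move=> p p' /enum_val_inj /(congr1 val) /= e.
  by apply/enum_rank_inj/val_inj.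
exists (fun j => [set h (j, i) | i : 'I_m]%SET); split.
- by move=> j; apply/fintype.subsetP => x /imsetP[i _ ->]; apply: enum_valP.
- by move=> j; rewrite card_imset ?card_ord// => i i' /hinj [].
- by move=> x j j' /imsetP[i _ ->] /imsetP[i' _] /hinj [].
Qed.

Lemma uphalf_bin_sqrt (R : realType) (m : nat) :
  Num.sqrt (m%:R / 8) <= (uphalf m * 'C(m, uphalf m))%:R / (2 ^ m)%:R :> R.
Proof.
set N := (uphalf m * _)%N.
have P0 : 0 < (2 ^ m)%:R :> R by rewrite ltr0n expn_gt0.
rewrite -[leRHS]ger0_norm ?divr_ge0// -sqrtr_sqr ler_wsqrtr//.
rewrite expr_div_n ler_pdivlMr ?exprn_gt0// mulrAC ler_pdivrMr//.
have := uphalf_bin_lower m; rewrite -/N -(ler_nat R) !natrM !natrX => h.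
rewrite mulrC [leRHS]mulrC exprAC -natrX mulrC; exact: h.
Qed.

Lemma planted_family (R : realType) (k n t B b : nat) (I : R) :
  (k < n)%N -> (0 < b)%N -> (B * b <= 'C(k, t))%N ->
  I <= b%:R / (2 ^ k)%:R * Num.sqrt ((n - k)%:R / 8) ->
  exists F : {set boolfun n},
    [/\ #|F| = B, forall f, f \in F -> monotone_boolfun f,
        forall f, f \in F -> I <= influence R f &
        forall x, (#|[set f in F | f x != threshold n k t x]%SET| <= 1)%N].
Proof.
move=> kn; have := subnKC (ltnW kn).
have : (0 < n - k)%N by rewrite subn_gt0.
(* Replaces n by k + m, so that prefixes and suffixes are typed. *)
move: (n - k)%N => m m0 e b0; case: n / e {kn} => BbN hI.
rewrite -card_hweight in BbN.
have [S [SL Sb Sd]] := disjoint_blocks BbN.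
have S0 j : S j != finset.set0 by rewrite -card_gt0 Sb.
have s0 : (0 < uphalf m)%N by rewrite uphalf_gt0.
exists [set planted m t (uphalf m) (S j) | j : 'I_B]%SET; split.
- by rewrite card_imset ?card_ord//; apply: planted_inj => // y j j'; apply: Sd.
- by move=> _ /imsetP[j _ ->]; apply: monotone_planted.
- move=> _ /imsetP[j _ ->]; apply: (le_trans hI).
  apply: le_trans (influence_planted R m t (uphalf m) (S j)).
  rewrite Sb natrM expnD [(2 ^ k * _)%:R]natrM invfM mulrACA.
  by rewrite ler_wpM2l ?divr_ge0// uphalf_bin_sqrt.
- move=> x; apply/card_le1_eqP => f g.
  rewrite !inE => /andP[/imsetP[j _ ->] hj] /andP[/imsetP[j' _ ->] hj'].
  by rewrite (Sd _ _ _ (planted_neq hj) (planted_neq hj')).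
Qed.

(** With k = 0 the empty prefix is the whole layer, and the planted function is the majority of all
    n bits. *)
Lemma monotone_high_influence (R : realType) (n : nat) :
  exists f : boolfun n,
    monotone_boolfun f /\ Num.sqrt (n%:R / 8) <= influence R f.
Proof.
exists (@planted 0 n 0 (uphalf n) [set y | hweight y == 0%N]%SET); split.
  exact: (@monotone_planted 0 n 0 (uphalf n) _ (subxx _)).
apply: le_trans (@influence_planted R 0 n 0 (uphalf n) _).
by rewrite card_hweight mul1n uphalf_bin_sqrt.
Qed.

(** * Logarithm estimates and the size of the layer *)

Lemma log2_ge (R : realType) (j n : nat) :
  (2 ^ j <= n)%N -> j%:R <= log2 (n%:R : R).
Proof.
move=> jn; have n0 : (0 < n)%N by apply: leq_trans jn; rewrite expn_gt0.
have l2 : 0 < ln 2 :> R by apply: ln_gt0; rewrite ltr1n.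
rewrite /log2 ler_pdivlMr// mulr_natl -lnXn// ler_ln ?posrE ?exprn_gt0 ?ltr0n//.
by rewrite -natrX ler_nat.
Qed.

(** For n < 16 the range of I* is empty. When n <= 1 the logarithm is 0 and division by 0 gives 0;
    otherwise some j in {1, 2} has 2^j <= n < 4^j, so the quotient is below 2^j / j = 2. *)
Lemma range_ge16 (R : realType) (n : nat) :
  2 <= Num.sqrt n%:R / log2 (n%:R : R) -> (16 <= n)%N.
Proof.
move=> h; rewrite leqNgt; apply/negP => n16.
have [n1|n1] := leqP n 1.
  have l0 : log2 (n%:R : R) = 0.
    case: n n1 {h n16} => [|[|]]// _; rewrite /log2; last by rewrite ln1 mul0r.
    by rewrite ln0 ?mul0r.
  by move: h; rewrite l0 invr0 mulr0; lra.
suff [j [j12 jn nj]] : exists j, [/\ (j == 1) || (j == 2), 2 ^ j <= n & n < (2 ^ j) ^ 2]%N.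
  have jL := log2_ge R jn.
  have L0 : 0 < log2 (n%:R : R) by case/orP: j12 jL => /eqP ->; lra.
  have sn : Num.sqrt n%:R < (2 ^ j)%:R :> R.
    rewrite -[ltRHS]ger0_norm// -sqrtr_sqr ltr_sqrt ?exprn_gt0 ?ltr0n ?expn_gt0//.
    by rewrite -natrX ltr_nat.
  move: h; rewrite ler_pdivlMr// => h.
  have : (2 * j)%:R < (2 ^ j)%:R :> R.
    by apply: le_lt_trans sn; apply: le_trans h; rewrite natrM ler_wpM2l.
  by rewrite ltr_nat; case/orP: j12 => /eqP ->.
have [n4|n4] := ltnP n 4; [by exists 1%N|by exists 2%N].
Qed.

Lemma klog_bounds (R : realType) (n : nat) : (0 < n)%N ->
  (n <= 2 ^ klog R n)%N /\ (klog R n)%:R <= 2 * log2 (n%:R : R) + 1.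
Proof.
move=> n0; set L := log2 _.
have l2 : 0 < ln 2 :> R by apply: ln_gt0; rewrite ltr1n.
have L0 : 0 <= L by have := @log2_ge R 0 n; apply.
have kE : (klog R n)%:R = (Num.ceil (2 * L))%:~R :> R.
  by rewrite /klog -/L natr_absz ger0_norm// ceil_ge0; lra.
have /andP[] := ceil_itv (2 * L); rewrite intrB -kE => klt kge; split; last by lra.
rewrite -(ler_nat R) natrX -ler_ln ?posrE ?exprn_gt0 ?ltr0n// lnXn//.
rewrite -[leRHS]mulr_natl -ler_pdivrMr// -/(log2 _) -/L; lra.
Qed.

Lemma bin_gt_influence (R : realType) (k t : nat) :
  t%:R < k%:R / 2 :> R -> 1 / 2 < influence R (threshold k k t) ->
  (2 ^ k)%:R < 2 * k%:R * 'C(k, t)%:R :> R.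
Proof.
move=> tk hI; have := lt_le_trans hI (influence_threshold R k t).
rewrite ltr_pdivlMr ?ltr0n ?expn_gt0// !natrM => h.
have : t%:R * 'C(k, t)%:R <= k%:R / 2 * 'C(k, t)%:R :> R.
  by rewrite ler_wpM2r// ltW.
lra.
Qed.

(* The influence of threshold n k t is the same for all n >= k, so the o(1)
   hypothesis on t, which is asymptotic in k only, is stated with n = k. *)
Theorem theorem2 (R : realType) (t : nat -> nat)
    (t_lt : \forall k \near \oo, (t k)%:R < (k%:R / 2 : R))
    (t_infl : (fun k : nat => influence R (threshold k k (t k))) @ \oo
                --> (1 : R)) :
  exists2 c : R, 0 < c &
    forall (n : nat) (Istar : R),
      2 <= Istar -> Istar <= Num.sqrt n%:R / log2 n%:R ->
      exists F : {set boolfun n},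
        [/\ F != finset.set0,
            forall f : boolfun n, f \in F -> monotone_boolfun f,
            forall f : boolfun n, f \in F -> Istar <= influence R f
          & forall (A : ralg R n) (q : nat),
              let k := klog R n in
              let tau := threshold n k (t k) in
              distinguishes A F tau ->
              (forall f : boolfun n, f \in F \/ f = tau ->
                 (query_count A f <= q)%N) ->
              c * (Num.sqrt n%:R / (Istar * log2 n%:R)) <= q%:R].
Proof.
have [k1 _ hk1] := t_lt.
have [k2 _ hk2] : \forall k \near \oo, 1 / 2 < influence R (threshold k k (t k)).
  by apply: (cvgr_gt _ t_infl); lra.
pose k0 := maxn k1 k2.
(* The term 2^k0 forces k > k0 once X > K; the term 96 = 2 * 48 absorbs the rounding in X < 48 (B +
   1). *)
have [K KE] : exists K : R, K = (2 ^ k0)%:R + 96 by eexists.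
have K96 : 96 <= K by rewrite KE lerDr.
exists (3 * K)^-1; first by rewrite invr_gt0; lra.
move=> n I I2 hI; have n16 := range_ge16 (le_trans I2 hI).
have n0 : (0 < n)%N by apply: leq_trans n16.
set a := Num.sqrt n%:R in hI *; set L := log2 _ in hI *.
have L4 : 4 <= L by apply: (log2_ge R (j := 4)).
have aE : a * a = n%:R by rewrite -expr2 sqr_sqrtr.
have IL : I * L <= a by rewrite -ler_pdivlMr//; lra.
have aL : 2 * L <= a by apply: le_trans IL; rewrite ler_wpM2r//; lra.
have a8 : 8 <= a by lra.
have IL0 : 0 < I * L by nra.
have IL8 : 8 <= I * L by nra.
set X := a / (I * L).
have XIL : X * (I * L) = a by rewrite /X divfK// gt_eqF.
(* If X <= K, the claimed bound is at most 1/3, and a one-element family already gives 1 <= 3q. *)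
have [XK|KX] := lerP X K.
  have [f [fmon fI]] := monotone_high_influence R n.
  exists [set f]%SET; split.
  - by apply/set0Pn; exists f; rewrite inE.
  - by move=> g; rewrite inE => /eqP ->.
  - move=> g; rewrite inE => /eqP ->; apply: le_trans fI.
    have -> : I = Num.sqrt (I * I) by rewrite -expr2 sqrtr_sqr ger0_norm; lra.
    have I4 : I * 4 <= a by nra.
    rewrite ler_wsqrtr// -aE ler_pdivlMr//; nra.
  - move=> A q k tau hA hq.
    have := distinguishes_card _ _ hA (hq tau (or_intror erefl)).
    rewrite cards1 => h; rewrite ler_pdivrMl; last lra.
    have : 1 <= 3 * q%:R :> R.
      apply: h; first by apply/set0Pn; exists f; rewrite inE.
      move=> x; rewrite -[leqRHS](cards1 f) subset_leq_card//.
      by apply/fintype.subsetP => g; rewrite !inE => /andP[].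
    move=> q3; have : K * 1 <= K * (3 * q%:R) by rewrite ler_wpM2l//; lra.
    rewrite -/X; lra.
move: (klog R n) (klog_bounds R n0) => k [nP]; rewrite -/L => kL.
have [P PE] : exists P : R, P = (2 ^ k)%:R by eexists.
have {}nP : a * a <= P by rewrite aE PE ler_nat.
have aa : a * 8 <= a * a by rewrite ler_wpM2l; lra.
have P0 : 0 < P by lra.
(* 2^k0 < X <= a/8 <= P = 2^k. *)
have k0k : (k0 < k)%N.
  rewrite -(ltn_exp2l _ _ (isT : 1 < 2)%N) -(ltr_nat R) -PE.
  move: KX; rewrite KE; set Q := (_ %:R) => KX.
  have X8 : X * 8 <= a by rewrite -XIL ler_wpM2l//; lra.
  have Q0 : 0 <= Q by [].
  lra.
have tk : (t k)%:R < k%:R / 2 :> R.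
  by apply: hk1 => /=; rewrite (leq_trans _ (ltnW k0k))// leq_maxl.
have hinf : 1 / 2 < influence R (threshold k k (t k)).
  by apply: hk2 => /=; rewrite (leq_trans _ (ltnW k0k))// leq_maxr.
have := bin_gt_influence tk hinf; rewrite -PE; set N := 'C(_, _) => PN.
(* k <= 2L + 1 <= a + 1, and a >= 8. Hence n - k >= n/2, which later gives sqrt((n - k)/8) >=
   a/4. *)
have kn2 : 2 * k%:R <= n%:R :> R by rewrite -aE; lra.
have kn : (k < n)%N by rewrite -(ltr_nat R); lra.
(* The real block size solving (u / P) (a / 4) = I. As u >= 1, its ceiling b is at most 2u. *)
pose u := 4 * I * P / a.
have ua : u * a = 4 * I * P by rewrite /u divfK//; lra.
have u1 : 1 <= u.
  have : 2 * P <= I * P by rewrite ler_wpM2r// ltW.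
  by rewrite /u ler_pdivlMr; lra.
pose b := `|Num.ceil u|%N.
have bE : b%:R = (Num.ceil u)%:~R :> R.
  by rewrite /b natr_absz ger0_norm// ceil_ge0; lra.
have /andP[] := ceil_itv u; rewrite intrB -bE => bu ub.
have b0 : (0 < b)%N by rewrite -(ltr_nat R); lra.
pose B := (N %/ b)%N.
have NB : N%:R < B.+1%:R * b%:R :> R by rewrite -natrM ltr_nat ltn_ceil.
(* Here P < 2kN <= 6LN and N < (B + 1) 2u, so P < 12 L (B + 1) u = 48 L (B + 1) I P / a. *)
have XB : X < 48 * (B%:R + 1).
  rewrite /X ltr_pdivrMr//; move: NB; rewrite -natr1.
  set B' := B%:R + 1; set N' := N%:R in PN * => NB.
  have B1 : 1 <= B' by rewrite lerDr.
  have {}NB : N' < B' * (2 * u).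
    by apply: lt_le_trans NB _; rewrite ler_wpM2l; lra.
  have N0 : 0 <= N' by [].
  have {}PN : P < 6 * L * N'.
    by apply: lt_le_trans PN _; rewrite ler_wpM2r//; lra.
  have {}PN : P < 6 * L * (B' * (2 * u)).
    by apply: lt_trans PN _; rewrite ltr_pM2l; lra.
  rewrite -(ltr_pM2r P0) mulrC.
  have -> : 48 * B' * (I * L) * P = 6 * L * (B' * (2 * u)) * a.
    transitivity (12 * L * B' * (u * a)); last by ring.
    by rewrite ua; ring.
  by rewrite ltr_pM2r; lra.
have B2 : 1 < B%:R :> R by lra.
have Iinf : I <= b%:R / (2 ^ k)%:R * Num.sqrt ((n - k)%:R / 8).
  rewrite -PE.
  have s4 : a / 4 <= Num.sqrt ((n - k)%:R / 8).
    have -> : a / 4 = Num.sqrt ((a / 4) * (a / 4)).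
      by rewrite -expr2 sqrtr_sqr ger0_norm//; lra.
    rewrite ler_wsqrtr// natrB ?(ltnW kn)// -[X in _ <= (X - _) / _]aE; lra.
  apply: (@le_trans _ _ (b%:R / P * (a / 4))); last first.
    by rewrite ler_wpM2l// divr_ge0// ltW.
  rewrite mulrAC ler_pdivlMr//.
  have : u * a <= b%:R * a by rewrite ler_wpM2r//; lra.
  lra.
have [F [FB Fmon Finf Fsep]] := planted_family kn b0 (leq_divM N b) Iinf.
have F0 : F != finset.set0 by rewrite -card_gt0 FB -(ltr_nat R); lra.
exists F; split=> // A q /= hA hq.
have := distinguishes_card F0 Fsep hA (hq _ (or_intror erefl)).
rewrite FB ler_pdivrMl -/B; last lra.
(* X < 48 (B + 1) <= 96 B <= 96 * 3q <= 3Kq. *)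
move=> Bq; rewrite -/X.
have : 96 * q%:R <= K * q%:R by rewrite ler_wpM2r.
lra.
Qed.
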